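(* Let $G$ be a finite directed graph, $k\ge1$ an integer, $r\in V(G)$ with positive in-degree and positive out-degree, and $\lambda,\delta\in(0,1)$. Suppose the sampling loop of algorithm APAD (described in the context) is executed a fixed number $\boldsymbol{\tau}$ of times, producing $\mathbf{c}=\frac1{\boldsymbol{\tau}}\sum_{\tau=1}^{\boldsymbol{\tau}}\mathbf{c}_\tau$. Then for all sufficiently large $\boldsymbol{\tau}$, $\mathbf{c}$ is a $(\lambda,\delta)$-approximation of $pc(r)$, i.e. $\mathbb{P}\left[|\mathbf{c}-pc(r)|\ge\lambda\right]\le\delta$.
   Context: $G$ is a finite, unweighted directed graph without self-loops or multiple edges, assumed (weakly) connected. $N(v)$ is the set of out-neighbours of $v$. For a vertex $s$ and integer $l\ge1$, $p_{s,l}$ denotes a simple directed path $s=u_0,u_1,\dots,u_l$ with $l$ edges starting at $s$; define $\mathcal{W}(p_{s,l})=\prod_{i=1}^{l}\frac{1}{|N(u_{i-1})\setminus\{s,u_1,\dots,u_{i-2}\}|}$ (for $i=1$ the removed set is $\{s\}$). $\chi[r\in p_{s,l}]$ is $1$ if $r$ is a vertex of $p_{s,l}$ and $0$ otherwise. The $k$-path centrality of $r$ is $pc(r)=\frac{1}{k|V(G)|}\sum_{s\in V(G)\setminus\{r\}}\sum_{1\le l\le k}\sum_{p_{s,l}}\chi[r\in p_{s,l}]\,\mathcal{W}(p_{s,l})$, the innermost sum over all simple paths with $l$ edges starting at $s$. $\mathcal{RF}(r)$ is the set of vertices $s\ne r$ with a directed path from $s$ to $r$; $\mathcal{RT}(r)$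 is the set of vertices $t\ne r$ with a directed path from $r$ to $t$; $\mathcal{D}(r)=\mathcal{RF}(r)\cup\{r\}\cup\mathcal{RT}(r)$. Algorithm APAD: let $RF=\mathcal{RF}(r)$, $D=\mathcal{D}(r)$. In each iteration $\tau$, independently: choose $s\in RF$ uniformly at random and $l\in\{1,\dots,k\}$ uniformly at random; build a path starting from $u_0=s$ where, for $i=1,\dots,l$, $u_i$ is chosen uniformly at random from $(N(u_{i-1})\cap D)\setminus\{s,u_1,\dots,u_{i-2}\}$; if this set is empty at some step, set $\mathbf{c}_\tau=0$. Otherwise the result is a path $p_{s,l}$ with $\mathbb{P}[p_{s,l}]=\prod_{i=1}^{l}\frac{1}{|(N(u_{i-1})\cap D)\setminus\{s,u_1,\dots,u_{i-2}\}|}$, and set $\mathbf{c}_\tau=\frac{|RF|\,\mathcal{W}(p_{s,l})}{|V(G)|\,\mathbb{P}[p_{s,l}]}$ if $r$ lies on $p_{s,l}$ and $\mathbf{c}_\tau=0$ otherwise. *)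

(* Defs.v *)
From HB Require Import structures.
From mathcomp Require Import all_boot all_order all_algebra.
From mathcomp Require Import all_classical all_reals all_analysis.

Set Implicit Arguments.
Unset Strict Implicit.
Unset Printing Implicit Defensive.

Import Order.TTheory GRing.Theory Num.Theory.
Local Open Scope ring_scope.

(* A finite digraph without multiple edges is a relation e on a finType V; a
   path u_0 = s, u_1, .., u_l is the pair of s and q = [:: u_1; ..; u_l].     *)

Section Graph.

Variables (V : finType) (e : rel V).

Definition weakly_connected : Prop :=
  forall x y : V, connect (fun a b => e a b || e b a) x y.

Definition outN (v : V) : {set V} := [set w | e v w].
Definition inN (v : V) : {set V} := [set u | e u v].

Definition RF (r : V) : {set V} := [set s | (s != r) && connect e s r].
Definition RT (r : V) : {set V} := [set t | (t != r) && connect e r t].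
Definition DD (r : V) : {set V} := RF r :|: [set r] :|: RT r.

Definition simple_path (s : V) (q : seq V) : bool :=
  path e s q && uniq (s :: q).

(* {s, u_1, .., u_(i-2)} for i >= 1; as the subtraction is truncated, this is
   {s} for i = 1.                                                            *)
Definition removed (s : V) (q : seq V) (i : nat) : {set V} :=
  s |: [set x in take (i - 2)%N q].

Definition nextW (s : V) (q : seq V) (i : nat) : {set V} :=
  outN (nth s (s :: q) i.-1) :\: removed s q i.

Definition nextD (r s : V) (q : seq V) (i : nat) : {set V} :=
  (outN (nth s (s :: q) i.-1) :&: DD r) :\: removed s q i.

End Graph.

Section Centrality.

Variables (R : realType) (V : finType) (e : rel V).

Definition path_weight (s : V) (q : seq V) : R :=
  \prod_(1 <= i < (size q).+1) (#|nextW e s q i|%:R)^-1.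

Definition path_centrality (k : nat) (r : V) : R :=
  (k%:R * #|V|%:R)^-1 *
  \sum_(s : V | s != r) \sum_(1 <= l < k.+1)
    \sum_(q : l.-tuple V | simple_path e s q)
      (r \in s :: q)%:R * path_weight s q.

Definition path_prob (r s : V) (q : seq V) : R :=
  \prod_(1 <= i < (size q).+1) (#|nextD e r s q i|%:R)^-1.

End Centrality.

(* The transcript (s, l, [:: u_1; ..; u_j]) of one iteration: the chosen source
   and length, and the vertices drawn before the walk either reached length l
   (j = l) or had no admissible next vertex (j < l).                         *)
Definition transcript (V : finType) (k : nat) : finType :=
  (V * 'I_k.+1 * k.-bseq V)%type.

Section Algorithm.

Variables (R : realType) (V : finType) (e : rel V) (k : nat) (r : V).

(* The probability that the walk which has already drawn q after s, and still
   has n vertices to draw, draws exactly the vertices w from now on.          *)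
Fixpoint walk_prob (n : nat) (s : V) (q w : seq V) : R :=
  match n, w with
  | 0, [::] => 1
  | 0, _ :: _ => 0
  | n'.+1, [::] => (nextD e r s q (size q).+1 == finset.set0)%:R
  | n'.+1, v :: w' =>
      if v \in nextD e r s q (size q).+1
      then (#|nextD e r s q (size q).+1|%:R)^-1 *
           walk_prob n' s (rcons q v) w'
      else 0
  end.

Definition iteration_prob (o : transcript V k) : R :=
  let: (s, l, q) := o in
  if (s \in RF e r) && (0 < l)%N
  then (#|RF e r|%:R)^-1 * (k%:R)^-1 * walk_prob l s [::] q
  else 0.

Definition iteration_value (o : transcript V k) : R :=
  let: (s, l, q) := o in
  if (size q == l) && (r \in s :: q)
  then (#|RF e r|%:R * path_weight R e s q) /
       (#|V|%:R * path_prob R e r s q)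
  else 0.

End Algorithm.

Local Open Scope classical_set_scope.
Local Open Scope ereal_scope.

(* A finite type is regarded as a measurable space in which every set is
   measurable.                                                               *)

Definition random_element (d : measure_display) (Omega : measurableType d)
    (A : finType) (X : Omega -> A) : Prop :=
  forall B : set A, measurable (X @^-1` B).

Definition mutually_independent (R : realType) (d : measure_display)
    (Omega : measurableType d) (P : probability Omega R)
    (A I : finType) (X : I -> Omega -> A) : Prop :=
  forall B : I -> set A,
    P (\bigcap_i (X i @^-1` B i)) = \prod_(i : I) P (X i @^-1` B i).

Definition apad_iterations (R : realType) (V : finType) (e : rel V)
    (k : nat) (r : V) (tau : nat) (d : measure_display)
    (Omega : measurableType d) (P : probability Omega R)
    (X : 'I_tau -> Omega -> transcript V k) : Prop :=
  [/\ forall i, random_element (X i),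
      mutually_independent P X &
      forall i o, P (X i @^-1` [set o]) = (iteration_prob R e r o)%:E].

Definition apad_estimate (R : realType) (V : finType) (e : rel V)
    (k : nat) (r : V) (tau : nat) (Omega : Type)
    (X : 'I_tau -> Omega -> transcript V k) (w : Omega) : R :=
  ((tau%:R)^-1 * \sum_(i < tau) iteration_value R e r (X i w))%R.

(* Main.v *)
(** Every walk drawn by APAD is a simple path inside D(r).  Conversely, on a
    simple path through r starting at s <> r the vertices before r lie in RF(r)
    and those after it in RT(r), so such a path is drawn with the positive
    probability P[p] and the factor W(p)/P[p] makes one iteration an unbiased
    estimator of pc(r).  The iterations are i.i.d. with finitely many outcomes,
    so Chebyshev's inequality for the finite product law gives the bound as soon
    as tau >= Var / (delta * lambda^2). *)
Require Import Defs.
From HB Require Import structures.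
From mathcomp Require Import all_boot all_order all_algebra.
From mathcomp Require Import all_classical all_reals all_analysis.
From mathcomp Require Import ring.
Local Open Scope classical_set_scope.
Local Open Scope ring_scope.
Set Implicit Arguments.
Unset Strict Implicit.
Unset Printing Implicit Defensive.
Import Order.TTheory GRing.Theory Num.Theory.

(** * Probability of a drawn walk *)

Section Walk.

Variables (R : realType) (V : finType) (e : rel V) (r : V).

(** The set for the next draw depends only on the last vertex of [s :: q] and on a prefix of [q], so
    later draws leave it unchanged. *)
Lemma nextD_cat (s : V) (q w : seq V) :
  nextD e r s (q ++ w) (size q).+1 = nextD e r s q (size q).+1.
Proof.
rewrite /nextD /removed /= -cat_cons nth_cat /= ltnSn take_cat.
case: ifP => // /negbT; rewrite -leqNgt => hq.
case: q hq => [|a q] /=; first by rewrite sub0n take0.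
by rewrite subSS subn1; case: (size q) => [|n] /=; rewrite ?ltnn // ltnNge leqnSn.
Qed.

(** With exactly [size w] draws left, the early-stop branch never occurs, and the recursion unrolls
    into admissibility indicators times uniform weights. The prefix [q] is general for the
    induction. *)
Lemma walk_probE (s : V) (q w : seq V) :
  walk_prob R e r (size w) s q w =
  \prod_((size q).+1 <= i < (size q + size w).+1)
    ((nth s (s :: q ++ w) i \in nextD e r s (q ++ w) i)%:R *
     (#|nextD e r s (q ++ w) i|%:R)^-1).
Proof.
elim: w q => [|v w IH] q; first by rewrite /= addn0 big_geq.
rewrite big_nat_recl ?addnS ?ltnS ?leq_addr //= nextD_cat nth_cat ltnn subnn /=.
case: ifP => _; last by rewrite !mul0r.
by rewrite mul1r IH size_rcons cat_rcons addSn big_add1.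
Qed.

Lemma connect_nth (s : V) (q : seq V) (i j : nat) :
  path e s q -> (i <= j <= size q)%N ->
  connect e (nth s (s :: q) i) (nth s (s :: q) j).
Proof.
move=> /(pathP s) eq /andP[+ jq]; elim: j jq => [|j IH] jq.
  by rewrite leqn0 => /eqP ->.
rewrite leq_eqVlt => /orP[/eqP -> //|ij].
by apply: connect_trans (IH (ltnW jq) ij) (connect1 _); exact: eq.
Qed.

(** Of [x] and [r], the one that comes first on the path reaches the other. *)
Lemma path_mem_DD (s : V) (q : seq V) (x : V) :
  path e s q -> r \in s :: q -> x \in s :: q -> x \in DD e r.
Proof.
move=> eq rq xq; rewrite !inE; case: eqVneq => //= xr; rewrite ?orbT //.
rewrite orbF.
have [rs xs] : (index r (s :: q) <= size q)%N /\ (index x (s :: q) <= size q)%N.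
  by split; rewrite -ltnS -[(size q).+1]/(size (s :: q)) index_mem.
rewrite -(nth_index s rq) -(nth_index s xq).
case/orP: (leq_total (index x (s :: q)) (index r (s :: q))) => h.
  by rewrite connect_nth ?h.
by rewrite orbC connect_nth ?h.
Qed.

Hypothesis e_irr : irreflexive e.

Lemma simple_path_nextD (s : V) (q : seq V) (i : nat) :
  simple_path e s q -> r \in s :: q -> (0 < i < (size q).+1)%N ->
  nth s (s :: q) i \in nextD e r s q i.
Proof.
case: i => // i /andP[eq uq] rq /= iq; rewrite ltnS in iq.
rewrite !inE; have /(pathP s)/(_ i iq) -> := eq.
have qi : nth s q i \in s :: q by rewrite inE mem_nth ?orbT.
have := path_mem_DD eq rq qi; rewrite !inE => -> /=; rewrite !andbT.
move: uq => /= /andP[sq uq]; rewrite negb_or; apply/andP; split.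
  by apply: contraNneq sq => <-; exact: mem_nth.
apply/negP => /(nthP s)[j]; rewrite size_take_min => jlt.
(* The removed set stops two places before the drawn vertex, so a hit would repeat a strictly
   earlier vertex and contradict uniqueness. *)
have {jlt}jlt : (j < i.-1)%N.
  by move: jlt; rewrite leq_min subSS subn1 => /andP[].
have ji : (j < i)%N by apply: leq_trans jlt (leq_pred _).
rewrite subSS subn1 nth_take // => /eqP.
rewrite nth_uniq ?(ltn_trans ji) //.
by rewrite (ltn_eqF ji).
Qed.

Lemma nextD_simple_path (s : V) (q : seq V) :
  (forall i, (0 < i < (size q).+1)%N -> nth s (s :: q) i \in nextD e r s q i) ->
  simple_path e s q.
Proof.
move=> H.
have eq : path e s q.
  apply/(pathP s) => i iq; have := H i.+1 iq.
  by rewrite !inE => /andP[_ /andP[]].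
rewrite /simple_path eq; apply/(uniqP s) => i j.
rewrite !inE.
wlog ij : i j / (i <= j)%N.
  move=> W hi hj E; case/orP: (leq_total i j) => h; first exact: W.
  by apply/esym; apply: W.
move: ij; rewrite leq_eqVlt => /orP[/eqP //|ij] _ jq E; exfalso.
case: j ij jq E => // j ij; rewrite ltnS => jq E.
have := H j.+1 jq; rewrite !inE -E.
(* The removed set omits the current vertex, so a repetition of consecutive vertices is excluded by
   the absence of self-loops; any earlier repetition hits [s] or the removed prefix. *)
move: ij; rewrite ltnS leq_eqVlt => /orP[/eqP ij|ij].
  by rewrite ij e_irr /= andbF.
case: i ij E => [|i] ij E /=; first by rewrite eqxx.
have -> : nth s q i \in take (j.+1 - 2) q; last by rewrite orbT.
have ij' : (i < j.+1 - 2)%N by case: j ij {jq E} => // j; rewrite subSS subn1.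
rewrite -(nth_take s ij') mem_nth // size_take; case: ifP => // _.
by apply: ltn_trans jq; exact: ltnW.
Qed.

(** For sequences through [r], every step is admissible exactly when the path is simple, so the
    product of indicators collapses to one. *)
Lemma walk_prob_path_prob (s : V) (q : seq V) :
  r \in s :: q ->
  walk_prob R e r (size q) s [::] q =
  (simple_path e s q)%:R * path_prob R e r s q.
Proof.
move=> rq; rewrite walk_probE add0n big_split /= -/(path_prob R e r s q).
congr (_ * _); case: (boolP (simple_path e s q)) => sq.
  by rewrite big_nat big1 // => i /(simple_path_nextD sq rq) ->.
apply/eqP; apply: contraNT sq; rewrite big_nat => nz.
apply: nextD_simple_path => i iq; apply: contraNT nz => /negbTE ni.
(* Splitting at an inadmissible step [i] exposes its zero factor. *)
rewrite -big_nat (big_cat_nat (n := i)) //=; last by case/andP: iq => _ /ltnW.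
  by rewrite [X in _ * X]big_ltn ?ni ?mul0r ?mulr0 //; case/andP: iq.
by case/andP: iq.
Qed.

Lemma path_prob_neq0 (s : V) (q : seq V) :
  simple_path e s q -> r \in s :: q -> path_prob R e r s q != 0.
Proof.
move=> sq rq; rewrite /path_prob big_nat prodf_seq_neq0.
apply/allP => i _; apply/implyP => iq; rewrite invr_eq0 pnatr_eq0 -lt0n.
by apply/card_gt0P; eexists; exact: simple_path_nextD iq.
Qed.

(** * Unbiasedness of one iteration *)

Lemma sum_bseq_size (k l : nat) (F : seq V -> R) : (l <= k)%N ->
  \sum_(q : k.-bseq V | size q == l) F q = \sum_(q : l.-tuple V) F q.
Proof.
move=> lk.
have tk (t : l.-tuple V) : (size t <= k)%N by rewrite size_tuple.
(* The constant tuple of [r] is only the default of [insubd], never reached when [size q == l]. *)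
rewrite (reindex_onto (fun t : l.-tuple V => Bseq (tk t))
  (fun q => insubd [tuple of nseq l r] (val q))) /=.
  apply: eq_bigl => t; rewrite size_tuple eqxx /=.
  by apply/eqP/val_inj; rewrite val_insubd size_tuple eqxx.
by move=> q sq; apply/val_inj; rewrite /= val_insubd sq.
Qed.

Hypothesis r_in : (0 < #|inN e r|)%N.

Lemma RF_gt0 : (0 < #|RF e r|)%N.
Proof.
case/card_gt0P: r_in => s; rewrite inE => sr; apply/card_gt0P; exists s.
by rewrite inE connect1 // andbT; apply: contraTneq sr => ->; rewrite e_irr.
Qed.

Local Arguments walk_prob : simpl never.

(** The sampling probability [1/(|RF| k) * P[p]] cancels the factor [|RF| / P[p]] of the value and
    leaves [W(p) / (k |V|)]. *)
Lemma expectation_iteration (k : nat) :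
  \sum_(o : transcript V k) iteration_prob R e r o * iteration_value R e r o =
  path_centrality R e k r.
Proof.
have RF0 : #|RF e r|%:R != 0 :> R by rewrite pnatr_eq0 -lt0n RF_gt0.
rewrite /path_centrality big_distrr /=.
transitivity (\sum_(s : V) \sum_(l < k.+1) \sum_(q : k.-bseq V)
   iteration_prob R e r (s, l, q) * iteration_value R e r (s, l, q)).
  rewrite pair_big pair_big /=; apply: eq_bigr => -[[s l] q] _ //=.
rewrite [RHS]big_mkcond /=; apply: eq_bigr => s _.
(* A source outside [RF e r] is never drawn, and no path from such an [s != r] meets [r]. *)
have [sRF|sRF] := boolP (s \in RF e r); last first.
  rewrite [LHS]big1; last first.
    by move=> l _; rewrite big1 // => q _; rewrite mul0r.
  case: eqP => //= sr; rewrite big1 ?mulr0 // => l _.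
  rewrite big1 // => q /andP[eq _].
  case: (boolP (r \in s :: q)) => rq; last by rewrite mul0r.
  case/negP: sRF; rewrite inE (path_connect eq rq) andbT.
  exact/eqP.
have -> : s != r by move: sRF; rewrite inE => /andP[].
(* The ordinals start at length 0, which has probability 0. *)
rewrite big_add1 big_mkord big_ord_recl /= big1 ?add0r; last first.
  by move=> q _; rewrite mul0r.
rewrite big_distrr /=; apply: eq_bigr => l _.
have lk : (lift ord0 l <= k)%N by exact: ltn_ord.
(* Transcripts whose size differs from the chosen length have value 0. *)
transitivity (\sum_(q : k.-bseq V | size q == lift ord0 l)
  (simple_path e s q)%:R * (k%:R * #|V|%:R)^-1 *
     ((r \in s :: q)%:R * path_weight R e s q)).
  rewrite [RHS]big_mkcond /=; apply: eq_bigr => q _.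
  case: (size q =P _ :> nat) => [<-|_] /=; last by rewrite mulr0.
  case: (boolP (r \in s :: q)) => rq; last by rewrite mul0r !mulr0.
  rewrite walk_prob_path_prob //.
  case: (boolP (simple_path e s q)) => sq; last by rewrite !mul0r mulr0 mul0r.
  have ppq := path_prob_neq0 sq rq.
  rewrite !mul1r !invfM.
  set pp := path_prob _ _ _ _ _; set W := path_weight _ _ _ _.
  set a := #|RF e r|%:R; set b := k%:R^-1; set c := #|V|%:R^-1.
  have -> : a^-1 * b * pp * (a * W * (c * pp^-1)) =
    (a^-1 * a) * (pp^-1 * pp) * (b * c * W) by ring.
  by rewrite !mulVf // !mul1r.
rewrite (sum_bseq_size (fun q => (simple_path e s q)%:R * (k%:R * #|V|%:R)^-1 *
     ((r \in s :: q)%:R * path_weight R e s q)) lk).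
rewrite big_distrr /= [RHS]big_mkcond /=; apply: eq_bigr => q _.
by case: ifP => _; rewrite ?mul1r // !mul0r.
Qed.

End Walk.


(** * Chebyshev's inequality for a finite product law *)

Section FiniteChebyshev.

Variables (R : realType) (A : finType) (p : A -> R).
Hypotheses (p_ge0 : forall a, 0 <= p a) (p_sum1 : \sum_a p a = 1).

(** Expanding the square, the off-diagonal terms vanish because the coordinates are independent and
    [g] is centred. *)
Lemma second_moment_sum (n : nat) (g : A -> R) :
  \sum_a p a * g a = 0 ->
  \sum_(f : {ffun 'I_n -> A}) (\prod_i p (f i)) * (\sum_i g (f i)) ^+ 2 =
  n%:R * \sum_a p a * g a ^+ 2.
Proof.
move=> g0.
have cross (i j : 'I_n) :
    \sum_(f : {ffun 'I_n -> A}) (\prod_m p (f m)) * (g (f i) * g (f j)) =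
    (i == j)%:R * \sum_a p a * g a ^+ 2.
  (* Spreading [g (f i) * g (f j)] over all coordinates lets the sum over [f] factor by
     distributivity. *)
  pose h (m : 'I_n) a := (if m == i then g a else 1) * (if m == j then g a else 1).
  transitivity (\prod_m \sum_a p a * h m a).
    rewrite bigA_distr_bigA /=; apply: eq_bigr => f _.
    rewrite big_split /= big_split /= -!big_mkcond /= !big_pred1_eq //.
  rewrite (bigD1 i) //=; have [ij|ij] := eqVneq i j.
    rewrite mul1r [X in _ * X]big1 ?mulr1; last first.
      move=> m mi; rewrite -[RHS]p_sum1; apply: eq_bigr => a _.
      by rewrite /h -ij (negbTE mi) !mulr1.
    by apply: eq_bigr => a _; rewrite /h -ij eqxx expr2.
  rewrite mul0r; under eq_bigr do rewrite /h eqxx (negbTE ij) mulr1.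
  by rewrite g0 mul0r.
transitivity (\sum_i \sum_j \sum_(f : {ffun 'I_n -> A})
    (\prod_m p (f m)) * (g (f i) * g (f j))).
  rewrite exchange_big /=; under [RHS]eq_bigr do rewrite exchange_big /=.
  rewrite [RHS]exchange_big /=; apply: eq_bigr => f _.
  rewrite expr2 big_distrlr /= big_distrr /= exchange_big; apply: eq_bigr => i _.
  by rewrite big_distrr.
under eq_bigr => i _.
  under eq_bigr do rewrite cross.
  rewrite (bigD1 i) //= eqxx mul1r [X in _ + X]big1 ?addr0; last first.
    by move=> j; rewrite eq_sym => /negbTE ->; rewrite mul0r.
  over.
by rewrite sumr_const card_ord mulr_natl.
Qed.

Lemma chebyshev_sample_mean (n : nat) (f : A -> R) (mu lambda : R) :
  (0 < n)%N -> 0 < lambda -> \sum_a p a * f a = mu ->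
  \sum_(o : {ffun 'I_n -> A} | lambda <= `|n%:R^-1 * (\sum_i f (o i)) - mu|)
     \prod_i p (o i) <=
  (\sum_a p a * (f a - mu) ^+ 2) / (n%:R * lambda ^+ 2).
Proof.
move=> n0 l0 fmu; have n0' : 0 < n%:R :> R by rewrite ltr0n.
have g0 : \sum_a p a * (f a - mu) = 0.
  under eq_bigr do rewrite mulrBr.
  by rewrite sumrB fmu -big_distrl /= p_sum1 mul1r subrr.
rewrite ler_pdivlMr ?mulr_gt0 ?exprn_gt0 //.
rewrite -(ler_pM2l n0') -(second_moment_sum n g0).
(* Markov's argument: on the deviation event the squared centred sum is at least [(n * lambda) ^ 2],
   elsewhere it is nonnegative. *)
rewrite mulrCA [X in _ * X]mulrA -expr2 -exprMn big_distrl /=.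
rewrite [leLHS]big_mkcond /=; apply: ler_sum => o _.
have po : 0 <= \prod_i p (o i) by apply: prodr_ge0.
case: ifP => h; last by rewrite mulr_ge0 // sqr_ge0.
rewrite ler_wpM2l // -[leRHS]real_normK ?num_real //.
rewrite lerXn2r ?nnegrE ?normr_ge0 ?mulr_ge0 ?(ltW n0') ?(ltW l0) //.
have -> : \sum_i (f (o i) - mu) = n%:R * (n%:R^-1 * (\sum_i f (o i)) - mu).
  rewrite sumrB sumr_const card_ord mulrBr mulVKf ?gt_eqF //.
  by rewrite mulr_natl.
by rewrite normrM (gtr0_norm n0') ler_pM2l.
Qed.

End FiniteChebyshev.


(** * Joint law of independent finite-valued samples *)

Section JointLaw.

Variables (R : realType) (d : measure_display) (Omega : measurableType d).
Variable P : probability Omega R.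

Lemma random_element_preimage (A : finType) (Y : Omega -> A) (B : {pred A}) :
  random_element Y ->
  P (Y @^-1` [set` B]) = (\sum_(a in B) P (Y @^-1` [set a]))%E.
Proof.
move=> mY.
have -> : Y @^-1` [set` B] = \bigcup_(a in [set` B]) (Y @^-1` [set a]).
  by apply/seteqP; split => w /= => [Bw|[a /= Ba ->//]]; exists (Y w).
rewrite measure_fin_bigcup //=.
- rewrite -(bigfs _ (index_enum_uniq A)) // => i _; rewrite mem_index_enum //.
- by move=> a b _ _ [w [/= -> ->]].
Qed.

Variables (A : finType) (n : nat) (X : 'I_n -> Omega -> A) (p : A -> R).
Hypotheses (X_meas : forall i, random_element (X i))
  (X_indep : mutually_independent P X)
  (X_law : forall i a, P (X i @^-1` [set a]) = (p a)%:E).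

Definition joint (w : Omega) : {ffun 'I_n -> A} := [ffun i => X i w].

Lemma joint_preimage1 (o : {ffun 'I_n -> A}) :
  joint @^-1` [set o] = \bigcap_i (X i @^-1` [set o i]).
Proof.
apply/seteqP; split => w /=; first by move=> <- i _ /=; rewrite ffunE.
by move=> H; apply/ffunP => i; rewrite ffunE; exact: H.
Qed.

Lemma joint_random_element : random_element joint.
Proof.
move=> B.
have -> : joint @^-1` B = \bigcup_(o in B) (joint @^-1` [set o]).
  by apply/seteqP; split => w /= => [Bw|[a /= Ba ->//]]; exists (joint w).
apply: fin_bigcup_measurable => [|o _]; first exact: finite_finset.
rewrite joint_preimage1; apply: fin_bigcap_measurable => [|i _]; last exact: X_meas.
exact: finite_finset.
Qed.

(** Independence gives the point masses, and finite additivity extends them to all events. *)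
Lemma joint_law (B : {pred {ffun 'I_n -> A}}) :
  P (joint @^-1` [set` B]) = (\sum_(o in B) \prod_i p (o i))%:E.
Proof.
rewrite (random_element_preimage B joint_random_element) -sumEFin.
apply: eq_bigr => o _; rewrite joint_preimage1 X_indep -prodEFin.
by apply: eq_bigr => i _; exact: X_law.
Qed.

Hypothesis n_gt0 : (0 < n)%N.

Lemma law_ge0 (a : A) : 0 <= p a.
Proof. by rewrite -lee_fin -(X_law (Ordinal n_gt0)) measure_ge0. Qed.

(** The total mass is inherited from [P] through the law of one sample, which exists since [0 < n];
    for APAD this replaces a computation over walks. *)
Lemma law_sum1 : \sum_a p a = 1.
Proof.
have := random_element_preimage predT (X_meas (Ordinal n_gt0)).
have -> : X (Ordinal n_gt0) @^-1` [set` predT] = setT by apply/seteqP; split.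
rewrite probability_setT => /esym; under eq_bigr do rewrite X_law.
by rewrite sumEFin => -[].
Qed.

End JointLaw.

(** * Choice of the sample size *)

Theorem theorem5p2 (R : realType) (V : finType) (e : rel V)
    (e_irr : irreflexive e) (e_conn : weakly_connected e)
    (k : nat) (k_ge1 : (1 <= k)%N)
    (r : V) (r_in : (0 < #|inN e r|)%N) (r_out : (0 < #|outN e r|)%N)
    (lambda delta : R)
    (lambda01 : 0 < lambda < 1) (delta01 : 0 < delta < 1) :
  exists T0 : nat, forall tau : nat, (T0 <= tau)%N ->
    forall (d : measure_display) (Omega : measurableType d)
           (P : probability Omega R)
           (X : 'I_tau -> Omega -> transcript V k),
    apad_iterations e r P X ->
    (P [set w | (lambda <=
         `|apad_estimate R e r X w - path_centrality R e k r|)%R]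
       <= delta%:E)%E.
Proof.
have /andP[l0 _] := lambda01; have /andP[d0 _] := delta01.
pose f := @iteration_value R V e k r; pose mu := path_centrality R e k r.
pose v := \sum_o iteration_prob R e r o * (f o - mu) ^+ 2.
(* The truncation plus one exceeds the Chebyshev threshold and also forces [tau] to be positive. *)
exists (Num.truncn (v / (delta * lambda ^+ 2))).+1 => tau tau_ge.
move=> d Omega P X [X_meas X_indep X_law].
have tau_gt0 : (0 < tau)%N by apply: leq_trans tau_ge.
pose bad (o : {ffun 'I_tau -> transcript V k}) :=
  lambda <= `|tau%:R^-1 * (\sum_i f (o i)) - mu|.
(* The estimate depends on [w] only through the joint sample, so the event becomes one of the finite
   product law. *)
have -> : [set w | lambda <= `|apad_estimate R e r X w - mu|] =
    joint X @^-1` [set` bad].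
  have est w : apad_estimate R e r X w = tau%:R^-1 * \sum_i f (joint X w i).
    by congr (_ * _); apply: eq_bigr => i _; rewrite ffunE.
  by apply/seteqP; split => w /=; rewrite est.
rewrite (joint_law X_meas X_indep X_law) lee_fin.
apply: le_trans
  (chebyshev_sample_mean (law_ge0 X_law tau_gt0) (law_sum1 X_meas X_law tau_gt0)
     tau_gt0 l0 (expectation_iteration R e_irr r_in k)) _.
rewrite -/f -/v ler_pdivrMr ?mulr_gt0 ?exprn_gt0 ?ltr0n //.
rewrite mulrCA -ler_pdivrMr ?mulr_gt0 ?exprn_gt0 //.
by apply: ltW; apply: lt_le_trans (truncnS_gt _) _; rewrite ler_nat.
Qed.
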